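(* Let $q=p^k$ be an odd prime power. Let $X$ be a cubic arc-transitive graph of type $\{1,2^1\}$ whose full automorphism group is $G^*=\mathrm{PGL}(2,q)$, such that $G=\mathrm{PSL}(2,q)\le G^*$ is a $1$-arc-regular subgroup of automorphisms. If $p\equiv 0,\pm 1\pmod 5$, then the intersection density of $G^*$ acting on the vertex set of $X$ is $\rho(G^* )=1$.
   Context: For a transitive permutation group $H\le \mathrm{Sym}(V)$, a subset $\mathcal F\subseteq H$ is intersecting if any two $f,g\in\mathcal F$ satisfy $f(v)=g(v)$ for some $v\in V$; the intersection density is $\rho(H)=\max\{|\mathcal F|:\mathcal F\subseteq H\text{ intersecting}\}/(|H|/|V|)$. An $s$-arc is a sequence $(u_0,\dots,u_s)$ of distinct vertices with consecutive ones adjacent; a group is $s$-arc-regular if it acts regularly on $s$-arcs. A cubic arc-transitive graph $X$ is of type $\{1,2^1\}$ if its full automorphism group acts regularly on $2$-arcs, it has a subgroup acting regularly on arcs, and the edge stabilizer in $\mathrm{Aut}(X)$ is isomorphic to $\mathbb{Z}_2^2$. *)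

(* Defs.v *)
From HB Require Import structures.
From mathcomp Require Import all_boot all_order all_algebra all_fingroup.
From mathcomp Require Import all_solvable.

Set Implicit Arguments.
Unset Strict Implicit.
Unset Printing Implicit Defensive.

Import Order.TTheory GRing.Theory Num.Theory GroupScope.

Section ProjectiveGroups.

Variables (n : nat) (F : finFieldType).

Definition SL : {set {'GL_n[F]}} := [set u | (\det (GLval u) == 1)%R].

Fact SL_group_set : group_set SL.
Proof.
apply/group_setP; split=> [|u v]; first by rewrite inE det1.
by rewrite !inE GL_ME det_mulmx => /eqP-> /eqP->; rewrite mulr1.
Qed.
Canonical SL_group := Group SL_group_set.

Definition PGL : {group coset_of 'Z('GL_n[F])} := ('GL_n[F] / 'Z('GL_n[F]))%G.

(* The image of SL in PGL, i.e. SL / (SL :&: 'Z(GL)) viewed as a subgroup of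
   PGL. *)
Definition PSL : {group coset_of 'Z('GL_n[F])} := (SL / 'Z('GL_n[F]))%G.

End ProjectiveGroups.

Section Density.

Variable V : finType.

Definition intersecting (S : {set {perm V}}) : bool :=
  [forall f in S, forall g in S, exists v, f v == g v].

Definition intersection_density (H : {set {perm V}}) : rat :=
  ((\max_(S : {set {perm V}} | (S \subset H) && intersecting S) #|S|)%N%:R
     / (#|H|%:R / #|V|%:R))%R.

End Density.

(* A graph on V is an adjacency relation, required to be symmetric and
   irreflexive by [simple_graph]. *)
Section Graphs.

Variables (V : finType) (adj : rel V).

Definition simple_graph : Prop := symmetric adj /\ irreflexive adj.

Definition cubic : Prop := forall x, #|[set y | adj x y]| = 3.

Definition AutG : {set {perm V}} :=
  [set s : {perm V} | [forall x, forall y, adj (s x) (s y) == adj x y]].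

Fact AutG_group_set : group_set AutG.
Proof.
apply/group_setP; split=> [|s t].
  by rewrite inE; apply/forallP=> x; apply/forallP=> y; rewrite !perm1.
rewrite !inE => /forallP sP /forallP tP.
apply/forallP=> x; apply/forallP=> y; rewrite !permM.
by rewrite (eqP (forallP (tP _) _)) (eqP (forallP (sP _) _)).
Qed.
Canonical AutG_group := Group AutG_group_set.

Definition arcs (s : nat) : {set s.+1.-tuple V} :=
  [set t : s.+1.-tuple V | uniq t && sorted adj t].

Definition arc_transitive (s : nat) (H : {set {perm V}}) : Prop :=
  [transitive H, on arcs s | 'P * s.+1].

Definition arc_regular (s : nat) (H : {set {perm V}}) : Prop :=
  arc_transitive s H /\
  {in arcs s, forall t : s.+1.-tuple V, 'C_H[t | 'P * s.+1] = 1}.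

Definition edge_stabilizer (x y : V) : {set {perm V}} :=
  'N_(AutG)([set x; y] | 'P).

Definition type_1_21 : Prop :=
  [/\ arc_regular 2 AutG,
      exists H : {group {perm V}}, H \subset AutG /\ arc_regular 1 H
    & forall x y, adj x y -> edge_stabilizer x y \isog [set: 'Z_2 * 'Z_2]].

End Graphs.

(* Main.v *)
Require Import Defs.
From mathcomp Require Import all_boot all_order all_algebra all_fingroup.
From mathcomp Require Import all_solvable finfield.
From mathcomp Require Import ring zify.

Set Implicit Arguments.
Unset Strict Implicit.
Unset Printing Implicit Defensive.

Import GRing.Theory GroupScope.

(** An element of PGL(2,q) that fixes a vertex has cube 1 if it lies in
    PSL(2,q), and square 1 otherwise.  Choose a matrix for each member of an
    intersecting family, and let B be the polar form of the determinant on the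
    4-dimensional space of 2x2 matrices.  Two members in the same coset of
    PSL(2,q) satisfy B(x,y)^2 = det x det y, two members in different cosets
    satisfy B(x,y) = 0.  After rescaling, the Gram matrix of each of the two
    coset parts is a scalar multiple of an integer matrix with 2 on the diagonal
    and 1 or -1 elsewhere, and the parts are orthogonal.  For seven matrices the
    resulting integer matrix always has a 5x5 principal minor whose only prime
    factors are 2 and 3, so in characteristic at least 5 five of the matrices
    would be linearly independent.  Hence an intersecting family has at most 6
    members, and 6 is the order of a vertex stabilizer. *)

(** * Minors of signed Gram matrices *)

Section Laplace.
Local Open Scope ring_scope.

(* Laplace expansion along the first row: unlike [\det], it can be evaluated. *)
Fixpoint ldet (R : comNzRingType) n (M : nat -> nat -> R) : R :=
  if n is n'.+1 then
    foldr +%R 0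
      [seq M 0%N j * ((if odd j then -1 else 1) *
                      ldet n' (fun i k => M i.+1 (bump j k))) | j <- iota 0 n]
  else 1.

Lemma det_ldet (R : comNzRingType) n (M : nat -> nat -> R) :
  \det (\matrix_(i < n, j < n) M i j) = ldet n M.
Proof.
elim: n M => [|n IHn] M; first by rewrite det_mx00.
rewrite (expand_det_row _ ord0) /=.
rewrite -[_ + _]/(foldr +%R 0 [seq _ | j <- iota 0 n.+1]).
rewrite foldrE big_map -[iota 0 n.+1]/(index_iota 0 n.+1) big_mkord.
apply: eq_bigr => j _; rewrite mxE /cofactor -IHn add0n -signr_odd.
congr (_ * (_ * _)); first by case: odd.
by congr (\det _); apply/matrixP => i k; rewrite !mxE.
Qed.

(** Allows a minor to be computed over the integers and only then reduced into the field. *)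
Lemma ldet_rmorph (R S : comNzRingType) (f : {rmorphism R -> S}) n M :
  ldet n (fun i j => f (M i j)) = f (ldet n M).
Proof.
elim: n M => [|n IHn] M /=; first by rewrite rmorph1.
rewrite rmorphD; congr (_ + _).
  by rewrite !rmorphM rmorph1 -(IHn (fun i k => _)).
elim: (iota 1 n) => [|j s IHs] /=; first by rewrite rmorph0.
rewrite rmorphD -IHs !rmorphM -(IHn (fun i k => _)); congr (_ * (_ * _) + _).
by case: odd; rewrite ?rmorphN rmorph1.
Qed.

Lemma eq_ldet (R : comNzRingType) n (M N : nat -> nat -> R) :
    (forall i j, (i < n)%N -> (j < n)%N -> M i j = N i j) ->
  ldet n M = ldet n N.
Proof.
move=> eqMN; rewrite -!det_ldet; congr (\det _).
by apply/matrixP => i j; rewrite !mxE eqMN.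
Qed.
End Laplace.

(** * Exhaustive search for a good principal minor *)

Section Search.

Fixpoint subseqs (s : seq nat) k : seq (seq nat) :=
  match k, s with
  | 0, _ => [:: [::]]
  | _.+1, [::] => [::]
  | k'.+1, x :: s' => [seq x :: t | t <- subseqs s' k'] ++ subseqs s' k
  end.

Lemma subseqsP s k t : t \in subseqs s k -> size t = k /\ {subset t <= s}.
Proof.
elim: s k t => [|x s IHs] [|k] t //=; rewrite ?inE; try by move/eqP->; split.
rewrite mem_cat => /orP[/mapP[t' /IHs[<- sub_t's] ->] | /IHs[<- sub_ts]].
  split=> // y; rewrite !inE => /predU1P[-> | /sub_t's->].
    by rewrite eqxx.
  by rewrite orbT.
by split=> // y /sub_ts; rewrite inE orbC => ->.
Qed.

Fixpoint signs k : seq (seq int) :=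
  if k is k'.+1 then [seq e :: s | e <- [:: 1%R; (-1)%R], s <- signs k']
  else [:: [::]].

Lemma mem_signs s :
  all (fun e : int => (e == 1%R) || (e == (-1)%R)) s -> s \in signs (size s).
Proof.
elim: s => //= e s IHs /andP[e1 /IHs s_in]; rewrite cats0 mem_cat.
by case/orP: e1 => /eqP->; rewrite map_f ?orbT.
Qed.

(* Row [i], up to the diagonal, of the normalized Gram matrix of two orthogonal
   parts, the first of size [n].  The first part is rescaled so that its first
   member has product 1 with the others. *)
Definition candidates n i : seq (seq int) :=
  if i < n then if i is i'.+1 then [seq 1%R :: s | s <- signs i'] else [:: [::]]
  else [seq nseq n 0%R ++ s | s <- signs (i - n)].

(* [rows] stores the strict lower triangle; the diagonal is constantly 2. *)
Definition entry (rows : seq (seq int)) i j : int :=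
  if i == j then 2%R else nth 0%R (nth [::] rows (maxn i j)) (minn i j).

Definition minor (M : nat -> nat -> int) (t : seq nat) : int :=
  ldet (size t) (fun a b => M (nth 0 t a) (nth 0 t b)).

(* 324 = 2^2 * 3^4: such a minor is a unit when 6 is. *)
Definition good (M : nat -> nat -> int) (t : seq nat) : bool :=
  `|minor M t|%N %| 324.

(** Only index sets containing the latest row are listed, since the others were already tried at
    earlier depths. Five indices exceed by one the dimension of the space of 2x2 matrices. *)
Definition new_minors i : seq (seq nat) :=
  if i is i'.+1 then [seq i' :: t | t <- subseqs (iota 0 i') 4] else [::].

(* [if find _ _ < size _] rather than [has] and [||], which call-by-value
   evaluation would not short-circuit. *)
Fixpoint search k n rows : bool :=
  let ts := new_minors (size rows) in
  if find (good (entry rows)) ts < size ts then true else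
  if k is k'.+1 then
    all (fun c => search k' n (rcons rows c)) (candidates n (size rows))
  else false.

Section Soundness.

Variable M : nat -> nat -> int.
Hypotheses (symM : forall i j, M i j = M j i) (diagM : forall i, M i i = 2%R).

Definition rows m := mkseq (fun i => mkseq (M i) i) m.

Lemma entry_rows m i j : i < m -> j < m -> entry (rows m) i j = M i j.
Proof.
rewrite /entry => lt_im lt_jm; case: eqP => [-> //| /eqP ne_ij].
rewrite nth_mkseq ?gtn_max ?lt_im // nth_mkseq; last by lia.
by rewrite /maxn /minn; case: ltnP.
Qed.

Lemma new_minorsP m t : t \in new_minors m -> good (entry (rows m)) t ->
  [/\ size t = 5, {in t, forall i, i < m} & good M t].
Proof.
case: m => // m /mapP[t' /subseqsP[sz_t' sub_t'] ->].
have lt_t: {in m :: t', forall i, i < m.+1}.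
  move=> i; rewrite inE => /predU1P[-> // | /sub_t'].
  by rewrite mem_iota => /andP[_ /ltnW].
move=> good_t; split; [by rewrite /= sz_t' | by [] |].
move: good_t; rewrite /good /minor; congr (`|_|%N %| _).
by apply: eq_ldet => a b lt_a lt_b; apply: entry_rows; apply/lt_t/mem_nth.
Qed.

(** Induction on [k] follows the branch of the search tree given by the actual rows of [M]. An
    exhausted branch returns [false], so a successful search has met a good minor on this branch. *)
Lemma searchP k n m :
    (forall i, i < m + k -> mkseq (M i) i \in candidates n i) ->
    search k n (rows m) ->
  exists t, [/\ size t = 5, {in t, forall i, i < m + k} & good M t].
Proof.
elim: k m => [|k IHk] m candM /=; rewrite size_mkseq -has_find.
  case: hasP => [[t /new_minorsP t_ok /t_ok[sz_t lt_t good_t]] _ | _ //].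
  by exists t; rewrite addn0.
case: hasP => [[t /new_minorsP t_ok /t_ok[sz_t lt_t good_t]] _ | _].
  by exists t; split=> // i /lt_t/leq_trans-> //; apply: leq_addr.
rewrite addnS -addSn in candM *.
move=> /allP/(_ (mkseq (M m) m)); rewrite candM ?leq_addr // => /(_ isT).
by rewrite -mkseqS; apply: IHk.
Qed.

End Soundness.

(** The finite computation. Here [n] counts the members of the larger part among seven matrices, so
    it ranges from 4 to 7. *)
Lemma search_ok n : 3 < n < 8 -> search 7 n [::].
Proof.
case/andP; case: n => [|[|[|[|[|[|[|[|n]]]]]]]]; try discriminate.
all: by move=> _ _; vm_compute.
Qed.

End Search.

(** * The polar form of the determinant and the bound of six *)

Section Polar.
Local Open Scope ring_scope.
Variable F : fieldType.
Implicit Types (u v : 'M[F]_2) (s t : seq 'M[F]_2).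

(** The form [\det (u + v) - \det u - \det v], expanded in coordinates so that [ring] can handle
    it. *)
Definition polar u v : F :=
  u 0 0 * v 1 1 + u 1 1 * v 0 0 - u 0 1 * v 1 0 - u 1 0 * v 0 1.

Lemma polarC u v : polar u v = polar v u.
Proof. rewrite /polar; ring. Qed.

Lemma polarZ a b u v : polar (a *: u) (b *: v) = a * b * polar u v.
Proof. rewrite /polar !mxE; ring. Qed.

Lemma det2 u : \det u = u 0 0 * u 1 1 - u 0 1 * u 1 0.
Proof.
rewrite (expand_det_row _ 0) !big_ord_recl big_ord0 /cofactor !det_mx11 !mxE /=.
have -> : lift 0 0 = 1 :> 'I_2 by apply: val_inj.
have -> : lift 1 0 = 0 :> 'I_2 by apply: val_inj.
ring.
Qed.

Lemma polarxx u : polar u u = 2%:R * \det u.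
Proof. rewrite det2 /polar; ring. Qed.

(** The Gram matrix factors through the 4-dimensional space of 2x2 matrices, so its rank is at most
    4. *)
Lemma det_polar n (v : nat -> 'M[F]_2) : (4 < n)%N ->
  \det (\matrix_(i < n, j < n) polar (v i) (v j)) = 0.
Proof.
move=> n_gt4.
pose X := \matrix_(i < n, k < 4)
  [:: v i 0 0; v i 1 1; - v i 0 1; - v i 1 0]`_k.
pose Y := \matrix_(k < 4, j < n) [:: v j 1 1; v j 0 0; v j 1 0; v j 0 1]`_k.
have ->: \matrix_(i < n, j < n) polar (v i) (v j) = X *m Y.
  apply/matrixP => i j; rewrite !mxE !big_ord_recl big_ord0 !mxE /= /polar.
  ring.
apply: contraTeq n_gt4; rewrite -unitfE -unitmxE -row_free_unit => /eqP rkXY.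
by rewrite -leqNgt -{}rkXY (leq_trans (mxrankM_maxl _ _)) ?rank_leq_col.
Qed.

(** Seven matrices would give, after rescaling, an integer Gram matrix covered by the search; its
    good 5x5 minor would be nonzero in [F], against [det_polar]. *)
Lemma size_equiangular s t : 6%:R != 0 :> F ->
    all (fun u => \det u != 0) (s ++ t) ->
    pairwise (fun u v => polar u v ^+ 2 == \det u * \det v) s ->
    pairwise (fun u v => polar u v ^+ 2 == \det u * \det v) t ->
    allrel (fun u v => polar u v == 0) s t ->
  (size s + size t <= 6)%N.
Proof.
move=> nz6; wlog le_ts: s t / (size t <= size s)%N.
  move=> IH det_st s_eq t_eq st_perp.
  have [le_ts|/ltnW le_st] := leqP (size t) (size s); first exact: IH.
  rewrite addnC; apply: IH => //; first by move: det_st; rewrite !all_cat andbC.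
  rewrite allrelC; apply: sub_all st_perp => u; apply: sub_all => v.
  by rewrite polarC.
move=> det_st s_eq t_eq st_perp; rewrite leqNgt; apply/negP => big_st.
pose m := size s; have mE : m = size s by []; pose x i := nth 0 (s ++ t) i.
(* [cls] tells the two parts apart, and [b i] is the index of the first member of the part
   containing [i], used as its base. *)
pose cls i := (i < m)%N; pose b i := if cls i then 0%N else m.
have det_x i: (i < 7)%N -> \det (x i) != 0.
  move=> lti; apply: (allP det_st); rewrite mem_nth // size_cat.
  exact: leq_trans lti big_st.
have m_gt3: (3 < m)%N by rewrite /m; lia.
have lt_b i: (i < 7)%N -> (b i < 7)%N by rewrite /b /cls; case: ifP => //; lia.
have polar_eq i j:
    (i < 7)%N -> (j < 7)%N -> i != j -> cls i = cls j ->
    polar (x i) (x j) ^+ 2 = \det (x i) * \det (x j).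
  wlog lt_ij: i j / (i < j)%N.
    move=> IH lti ltj; rewrite neq_ltn => /orP[lt_ij|lt_ji] cls_ij.
      by apply: IH; rewrite // ltn_eqF.
    by rewrite polarC mulrC; apply: IH; rewrite // ltn_eqF.
  move=> lti ltj _; rewrite /x !nth_cat /cls -/m.
  case: ltnP => [im | mi] /esym.
    by move=> jm; rewrite jm; apply/eqP/(pairwiseP 0 s_eq).
  case: ltnP => // mj _; apply/eqP.
  by apply: (pairwiseP 0 t_eq); rewrite -?topredE /=; lia.
have polar0 i j:
    (i < 7)%N -> (j < 7)%N -> cls i != cls j -> polar (x i) (x j) = 0.
  wlog lt_ij: i j / (i < j)%N.
    move=> IH lti ltj; have [lt_ij|lt_ji|->] := ltngtP i j.
    - exact: IH.
    - by rewrite polarC eq_sym; apply: IH.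
    by rewrite eqxx.
  move=> lti ltj; rewrite /x !nth_cat /cls -/m.
  case: ltnP => [im|mi]; last by rewrite ltnNge (leq_trans mi) ?(ltnW lt_ij).
  case: ltnP => // mj _; apply/eqP/(allrelP st_perp); apply: mem_nth => //.
  by rewrite ltn_subLR // (leq_trans ltj).
pose d i := \det (x (b i)).
(* This scaling makes the product of each vector with its base equal to [d i]; since the squared
   product is [d i * \det (x i)], every determinant in the part becomes [d i] as well. *)
pose c i := if i == b i then 1 else d i / polar (x (b i)) (x i).
pose v i := c i *: x i.
have cls_b i: cls (b i) = cls i by rewrite /b /cls; case: ifP; lia.
have b_b i: b (b i) = b i by rewrite {1}/b cls_b.
have nz_d i: (i < 7)%N -> d i != 0 by move=> /lt_b/det_x.
have polar_b i: (i < 7)%N -> i != b i ->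
    polar (x (b i)) (x i) ^+ 2 = d i * \det (x i).
  by move=> lti ne_ib; rewrite polar_eq ?lt_b // eq_sym.
have nz_polar_b i: (i < 7)%N -> i != b i -> polar (x (b i)) (x i) != 0.
  by move=> lti ne_ib; rewrite -sqrf_eq0 polar_b // mulf_neq0 ?nz_d ?det_x.
have v_b i: (i < 7)%N -> i != b i -> polar (v (b i)) (v i) = d i.
  move=> lti ne_ib; rewrite /v polarZ /c b_b eqxx mul1r (negPf ne_ib).
  by rewrite mulfVK ?nz_polar_b.
have det_v i: (i < 7)%N -> \det (v i) = d i.
  move=> lti; rewrite /v detZ /c; case: eqP => [bi | /eqP ne_ib].
    by rewrite expr1n mul1r /d -bi.
  rewrite expr_div_n polar_b //; have := nz_d i lti; have := det_x i lti.
  by move=> nz1 nz2; field; rewrite nz1 nz2.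
pose M i j : int := if i == j then 2 else
  if cls i != cls j then 0 else if polar (v i) (v j) == d i then 1 else -1.
have gramE i j: (i < 7)%N -> (j < 7)%N ->
    polar (v i) (v j) = d i * (M i j)%:~R.
  move=> lti ltj; rewrite /M; case: eqP => [<-|/eqP ne_ij].
    by rewrite polarxx det_v // mulrC.
  case: eqP => [cls_ij | /eqP cls_ij] /=.
    2: by rewrite polarZ polar0 // !mulr0.
  case: eqP => [->|/eqP ne_d]; first by rewrite mulr1.
  have dij: d i = d j by rewrite /d /b cls_ij.
  (* All determinants in a part now agree, so the product is [d i] up to sign, which justifies the
     default -1 in [M]. *)
  have: polar (v i) (v j) ^+ 2 == d i ^+ 2.
    rewrite polarZ exprMn polar_eq // [d i ^+ 2]expr2 {2}dij -!det_v //.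
    by rewrite /v !detZ; apply/eqP; ring.
  by rewrite eqf_sqr (negPf ne_d) mulrN1 => /eqP.
have symM i j : M i j = M j i.
  rewrite /M eq_sym; case: eqP => // _; rewrite (eq_sym (cls i)).
  case: eqP => //= eq_c; by rewrite polarC /d /b eq_c.
have diagM i : M i i = 2 by rewrite /M eqxx.
(* The first part may have more than seven members while only seven indices are inspected, hence the
   [minn]. *)
have [] := @searchP M symM diagM 7 (minn 7 m) 0.
- move=> i lti; rewrite /candidates; set n := minn 7 m.
  have nE: (i < n)%N = cls i by rewrite /n /cls; lia.
  rewrite nE; case cls_i: (cls i).
    case: i => // i in lti nE cls_i *.
    (* Column 0 belongs to the base of the first part, so its entry is normalized to 1. *)
    have -> : mkseq (M i.+1) i.+1 = 1 :: [seq M i.+1 j | j <- iota 1 i].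
      rewrite /mkseq /=; congr (_ :: _); rewrite /M /=.
      have cls0 : cls 0%N by rewrite /cls; lia.
      have := v_b i.+1 lti; rewrite cls_i cls0 /= /b cls_i polarC => -> //.
      by rewrite eqxx.
    apply: map_f; rewrite -[i in signs i](size_iota 1) -(size_map (M i.+1)).
    apply: mem_signs; apply/allP => _ /mapP[j + ->].
    rewrite mem_iota /M => lt_j.
    have cls_j : cls j by move: cls_i; rewrite /cls; lia.
    have /negPf-> : i.+1 != j by lia.
    by rewrite cls_i cls_j /=; case: ifP; rewrite ?eqxx ?orbT.
  have le_ni: (n <= i)%N by rewrite leqNgt nE cls_i.
  have nm: n = m by move: cls_i; rewrite /cls /n; lia.
  have -> : mkseq (M i) i = nseq n 0 ++ [seq M i j | j <- iota n (i - n)].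
    rewrite /mkseq -[i in iota 0 i](subnKC le_ni) iotaD map_cat add0n.
    congr (_ ++ _); apply: (@eq_from_nth _ 0).
      by rewrite size_map size_iota size_nseq.
    rewrite size_map size_iota => j lt_jn.
    rewrite (nth_map 0%N) ?size_iota // nth_iota // nth_nseq lt_jn.
    have cls_j : cls j by rewrite /cls -nm.
    rewrite /M cls_i cls_j /=; case: eqP => // eq_ij.
    by rewrite eq_ij cls_j in cls_i.
  apply: map_f; rewrite -[X in signs X](size_iota n) -(size_map (M i)).
  apply: mem_signs; apply/allP => _ /mapP[j + ->]; rewrite mem_iota /M => lt_j.
  have cls_j : cls j = false by rewrite /cls; lia.
  have /negPf-> : i != j by lia.
  by rewrite cls_i cls_j /=; case: ifP; rewrite ?eqxx ?orbT.
- by have /search_ok: (3 < minn 7 m < 8)%N by lia.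
move=> t5 [sz_t5 lt_t5]; rewrite /good /minor sz_t5.
pose y a := nth 0%N t5 a; have lt_y a: (a < 5)%N -> (y a < 7)%N.
  by move=> lt_a; apply/lt_t5/mem_nth; rewrite sz_t5.
set N := ldet 5 _ => dvdN.
(* The 5x5 Gram determinant vanishes and equals the product of the nonzero [d (y i)] with the image
   of [N]. *)
have N0: N%:~R = 0 :> F.
  have: \det (\matrix_(i < 5, j < 5) polar (v (y i)) (v (y j))) = 0.
    exact: det_polar (fun a => v (y a)) _.
  have -> : \matrix_(i < 5, j < 5) polar (v (y i)) (v (y j)) =
      diag_mx (\row_(i < 5) d (y i)) *m
      \matrix_(i < 5, j < 5) (M (y i) (y j))%:~R.
    by apply/matrixP => i j; rewrite mul_diag_mx !mxE gramE ?lt_y.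
  rewrite det_mulmx det_diag (det_ldet 5 (fun i j => (M (y i) (y j))%:~R)).
  rewrite (ldet_rmorph intr 5 (fun i j => M (y i) (y j))) => /eqP.
  rewrite mulf_eq0 prodf_seq_eq0 => /orP[/hasP[i _] | /eqP//].
  by rewrite mxE /= (negPf (nz_d _ _)) // lt_y.
have N_eq0: (absz N)%:R == 0 :> F.
  apply/eqP; case: (intP N) N0 => [|n|n] //.
  by rewrite rmorphN abszN /= => /eqP; rewrite oppr_eq0 => /eqP.
case/dvdnP: dvdN => q def324.
have: 324%:R == 0 :> F by rewrite def324 natrM (eqP N_eq0) mulr0.
apply/negP; have -> : 324%:R = 6%:R * 6%:R * (3%:R * 3%:R) :> F by ring.
have nz3 : 3%:R != 0 :> F.
  by apply: contraNneq nz6 => eq3; rewrite -[6%N]/(2 * 3)%N natrM eq3 mulr0.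
by rewrite !mulf_neq0.
Qed.
End Polar.

(** * Matrices representing elements of PGL(2,q) *)

(** The unit group is cyclic and nonsquares are odd powers of a generator, so the exponents add up
    to an even number. *)
Lemma mul_nonsquares (F : finFieldType) (x y : F) :
    (forall c, x != c ^+ 2)%R -> (forall c, y != c ^+ 2)%R ->
  exists c, (x * y = c ^+ 2)%R.
Proof.
move=> x_ns y_ns.
have /cyclicP[g def_g] := field_unit_group_cyclic [set: {unit F}]%G.
have pow_g z : (forall c, z != c ^+ 2)%R ->
    exists2 n, odd n & z = (val g ^+ n)%R.
  move=> z_ns; have z_unit : z \is a GRing.unit.
    by rewrite unitfE; apply: contraNneq (z_ns 0%R) => ->; rewrite expr0n.
  have /cycleP[n def_z] : FinRing.unit F z_unit \in <[g]> by rewrite -def_g inE.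
  have z_eq : z = (val g ^+ n)%R by rewrite -FinRing.val_unitX -def_z.
  exists n => //; apply: contraT => n_even; case/negP: (z_ns (val g ^+ n./2)%R).
  by rewrite z_eq -exprM muln2 even_halfK.
have [[a odd_a ->] [b odd_b ->]] := (pow_g x x_ns, pow_g y y_ns).
exists (val g ^+ (a + b)./2)%R.
by rewrite -exprD -exprM muln2 even_halfK // oddD odd_a odd_b.
Qed.

Section Matrices2.
Local Open Scope ring_scope.
Variable F : fieldType.
Implicit Types (w y : 'M[F]_2).

Lemma mx2P w y : w 0 0 = y 0 0 -> w 0 1 = y 0 1 -> w 1 0 = y 1 0 ->
  w 1 1 = y 1 1 -> w = y.
Proof.
move=> e00 e01 e10 e11; apply/matrixP => i j.
have ord2 (k : 'I_2) : k = 0 \/ k = 1.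
  by case: k => [[|[|//]] ltk]; [left | right]; apply: val_inj.
by case: (ord2 i) => ->; case: (ord2 j) => ->.
Qed.

Lemma mul2E w y i j : (w *m y) i j = w i 0 * y 0 j + w i 1 * y 1 j.
Proof.
rewrite mxE !big_ord_recl big_ord0 addr0.
by have -> : lift 0 0 = 1 :> 'I_2 by apply: val_inj.
Qed.

Lemma tr2E w : \tr w = w 0 0 + w 1 1.
Proof.
rewrite /mxtrace !big_ord_recl big_ord0 addr0.
by have -> : lift 0 0 = 1 :> 'I_2 by apply: val_inj.
Qed.

(** Turns the product of two matrices under the form into the trace of their quotient [w]. *)
Lemma polar_mull w y : polar (w *m y) y = \tr w * \det y.
Proof. rewrite /polar !mul2E tr2E det2; ring. Qed.

Lemma scalar2P w :
  reflect [/\ w 0 1 = 0, w 1 0 = 0 & w 0 0 = w 1 1] (is_scalar_mx w).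
Proof.
apply: (iffP is_scalar_mxP) => [[a ->] | [w01 w10 w00]].
  by rewrite !mxE /= mulr1n mulr0n.
by exists (w 1 1); apply: mx2P; rewrite !mxE ?w01 ?w10 ?w00.
Qed.

(** By Cayley-Hamilton, [w ^ 2] is [\tr w] times [w] plus a scalar matrix; the proof checks this on
    the off-diagonal entries and on the difference of the diagonal ones. *)
Lemma tr_sqr_scalar w :
  ~~ is_scalar_mx w -> is_scalar_mx (w *m w) -> \tr w = 0.
Proof.
move=> nsc_w /scalar2P[]; rewrite !mul2E tr2E => e01 e10 e00.
apply: contraNeq nsc_w => nz_t; apply/scalar2P.
split; apply: (mulfI nz_t).
- by rewrite mulr0 -e01; ring.
- by rewrite mulr0 -e10; ring.
by apply: subr0_eq; move/eqP: e00; rewrite -subr_eq0 => /eqP <-; ring.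
Qed.

(** By Cayley-Hamilton, [w ^ 3] is [\tr w ^ 2 - \det w] times [w] plus a scalar matrix. *)
Lemma tr_cube_scalar w :
  ~~ is_scalar_mx w -> is_scalar_mx (w *m w *m w) -> \tr w ^+ 2 = \det w.
Proof.
move=> nsc_w /scalar2P[]; rewrite !mul2E tr2E det2 => e01 e10 e00.
apply/eqP; rewrite -subr_eq0; apply: contraR nsc_w => nz_t; apply/scalar2P.
split; apply: (mulfI nz_t).
- by rewrite mulr0 -e01; ring.
- by rewrite mulr0 -e10; ring.
by apply: subr0_eq; move/eqP: e00; rewrite -subr_eq0 => /eqP <-; ring.
Qed.

End Matrices2.

Section PGL2.
Variable F : finFieldType.
Local Notation GL := 'GL_2[F].
Implicit Types (x y z : {'GL_2[F]}).

Let in_normZ x : x \in 'N('Z(GL)).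
Proof. by apply: (subsetP (gFnorm _ _)); rewrite inE. Qed.

Lemma GL_exists (w : 'M[F]_2) : (\det w != 0)%R -> exists x, GLval x = w.
Proof.
rewrite -unitfE -unitmxE => w_unit.
by exists (FinRing.unit 'M[F]_2 w_unit).
Qed.

Lemma center_GL2 z : (z \in 'Z(GL)) = is_scalar_mx (GLval z : 'M_2).
Proof.
apply/idP/is_scalar_mxP => [/centerP[_ z_cent] | [c zE]]; last first.
  apply/centerP; split=> [|x _]; first by rewrite inE.
  apply: val_inj; change (GLval z *m GLval x = GLval x *m GLval z)%R.
  by rewrite zE; apply: comm_scalar_mx.
apply/is_scalar_mxP/scalar2P.
have commz (w : 'M[F]_2) : (\det w != 0 -> GLval z *m w = w *m GLval z)%R.
  by case/GL_exists=> x <-; rewrite -!GL_MxE z_cent ?inE.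
(* Commuting with the two elementary transvections already forces a matrix to be scalar. *)
pose w01 : 'M[F]_2 := (1%:M + delta_mx 0 1)%R.
pose w10 : 'M[F]_2 := (1%:M + delta_mx 1 0)%R.
have /commz/matrixP e01 : (\det w01 != 0)%R.
  rewrite det2 !mxE /= !(mulr0n, mulr1n, addr0, add0r, mulr0, subr0, mulr1).
  by rewrite oner_eq0.
have /commz/matrixP e10 : (\det w10 != 0)%R.
  rewrite det2 !mxE /= !(mulr0n, mulr1n, addr0, add0r, mul0r, subr0, mulr1).
  by rewrite oner_eq0.
have := (e01 0 1, e01 1 1, e10 0 0)%R; rewrite !mul2E !mxE /=.
rewrite !(mulr0n, mulr1n, addr0, add0r, mul0r, mulr0, subr0, mulr1, mul1r).
move=> {e01 e10}[[e00 e10] e01].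
have z01 : (GLval z 0 1 = 0)%R.
  by apply: (addrI (GLval z 0 0)%R); rewrite e01 addr0.
have z10 : (GLval z 1 0 = 0)%R.
  by apply: (addIr (GLval z 1 1)%R); rewrite e10 add0r.
by split=> //; move: e00; rewrite z01 addr0 add0r.
Qed.

(** Dividing by the central scalar matrix [c], of determinant [c ^ 2], keeps the coset and makes the
    determinant 1. *)
Lemma PSL_square x c : (\det (GLval x) = c ^+ 2)%R ->
  coset 'Z(GL) x \in PSL 2 F.
Proof.
move=> det_x; have nz_c : (c != 0)%R.
  by have := GL_det x; rewrite det_x expf_eq0.
have [|z zE] := @GL_exists c%:M; first by rewrite det_scalar expf_neq0.
have z_cent : z \in 'Z(GL) by rewrite center_GL2 zE scalar_mx_is_scalar.
have -> : coset 'Z(GL) x = coset 'Z(GL) (z^-1 * x).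
  by rewrite coset_kerl ?groupV.
apply: mem_quotient; rewrite inE; apply/eqP/(mulfI (expf_neq0 2 nz_c)).
have det_z : (\det (GLval z) = c ^+ 2)%R by rewrite zE det_scalar.
by rewrite mulr1 -{1}det_z -det_mulmx -GL_MxE mulKVg.
Qed.

(** The index of PSL in PGL is at most 2: representatives of nonmembers have nonsquare determinants,
    and the product of two nonsquares is a square. *)
Lemma PSL_mul_nonmembers (a b : coset_of 'Z(GL)) :
  a \in PGL 2 F -> a \notin PSL 2 F -> b \in PGL 2 F -> b \notin PSL 2 F ->
  a * b \in PSL 2 F.
Proof.
have lift_ns x : coset 'Z(GL) x \notin PSL 2 F ->
    forall c, (\det (GLval x) != c ^+ 2)%R.
  by move=> x_ns c; apply: contraNneq x_ns => /PSL_square.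
case/morphimP=> x nZx _ -> /lift_ns x_ns.
case/morphimP=> y nZy _ -> /lift_ns y_ns.
have [c det_xy] := mul_nonsquares x_ns y_ns.
by rewrite -morphM //; apply: (@PSL_square _ c); rewrite GL_ME det_mulmx.
Qed.

Lemma coset_repr_mul (a b : coset_of 'Z(GL)) :
  exists2 x, a * b^-1 = coset 'Z(GL) x &
    GLval (repr a) = (GLval x *m GLval (repr b))%R.
Proof.
exists (repr a * (repr b)^-1).
  by rewrite morphM ?morphV ?in_normZ //= !coset_reprK.
by rewrite -GL_MxE mulgKV.
Qed.

Lemma coset_nonscalar x : coset 'Z(GL) x != 1 ->
  ~~ is_scalar_mx (GLval x : 'M_2).
Proof. by rewrite -center_GL2; apply: contra => /coset_id->. Qed.

Lemma coset_expg1 x n : coset 'Z(GL) x ^+ n = 1 ->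
  is_scalar_mx (GLval (x ^+ n) : 'M_2).
Proof.
by rewrite -morphX ?in_normZ // -center_GL2 => /coset_idr; apply.
Qed.

Lemma polar_order2 (a b : coset_of 'Z(GL)) :
  a != b -> (a * b^-1) ^+ 2 = 1 ->
  polar (GLval (repr a)) (GLval (repr b)) = 0%R.
Proof.
rewrite eq_mulgV1; have [x -> ->] := coset_repr_mul a b.
move=> /coset_nonscalar nsc_x /coset_expg1; rewrite expgS expg1 GL_MxE => sc_x.
by rewrite polar_mull (tr_sqr_scalar nsc_x sc_x) mul0r.
Qed.

Lemma polar_order3 (a b : coset_of 'Z(GL)) :
  a != b -> (a * b^-1) ^+ 3 = 1 ->
  (polar (GLval (repr a)) (GLval (repr b)) ^+ 2 =
    \det (GLval (repr a)) * \det (GLval (repr b)))%R.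
Proof.
rewrite eq_mulgV1; have [x -> ->] := coset_repr_mul a b.
move=> /coset_nonscalar nsc_x /coset_expg1.
rewrite !expgS expg0 mulg1 mulgA !GL_MxE => sc_x.
rewrite polar_mull exprMn (tr_cube_scalar nsc_x sc_x) det_mulmx.
by rewrite -mulrA -expr2.
Qed.

End PGL2.

(** * Vertex stabilizers *)

(** A permutation of three points without a fixed point is a 3-cycle. *)
Lemma perm_card3 (T : finType) (s : {perm T}) (N : {set T}) :
    #|N| = 3 -> {homo s : x / x \in N} ->
  (exists2 x, x \in N & s x = x) \/ {in N, forall x, (s ^+ 3) x = x}.
Proof.
move=> cardN sN.
case: (pickP (fun x => (x \in N) && (s x == x))) => [x|no_fix].
  by case/andP=> Nx /eqP sx; left; exists x.
have ne_s x : x \in N -> s x != x.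
  by move=> Nx; have := no_fix x; rewrite Nx => /negbT.
right=> a Na; rewrite !expgS expg0 mulg1 !permM.
have small (l : seq T) : uniq l -> all [in N] l -> size l <= 3.
  move=> Ul /allP lN; rewrite -cardN cardE; apply: uniq_leq_size => // x /lN.
  by rewrite mem_enum.
have [ssa | ne_ssa] := eqVneq (s (s a)) a.
  have /subsetPn[c Nc] : ~~ (N \subset [set a; s a]).
    by apply: contraL isT => /subset_leq_card; rewrite cardN cards2; case: eqP.
  rewrite !inE negb_or => /andP[ne_ca ne_csa].
  have /small : uniq [:: a; s a; c; s c].
    rewrite /= !inE !negb_or andbT (eq_sym a) ne_s // (eq_sym a c) ne_ca.
    rewrite (eq_sym _ c) ne_csa (eq_sym c (s c)) ne_s //.
    (* If [s] swaps [a] and [s a], then a third point [c] and its image are new, which makes four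
       points in [N]. *)
    rewrite -{1}ssa (inj_eq perm_inj).
    by rewrite (eq_sym _ c) ne_csa (inj_eq perm_inj) (eq_sym a) ne_ca.
  by rewrite /= Na Nc !sN //= => /(_ isT).
apply/eqP; apply: contraT => ne_sssa.
have /small : uniq [:: a; s a; s (s a); s (s (s a))].
  rewrite /= !inE !negb_or andbT !(inj_eq perm_inj) (eq_sym a (s a)) ne_s //.
  by rewrite (eq_sym a (s (s a))) ne_ssa (eq_sym a) ne_sssa.
by rewrite /= Na !sN //= => /(_ isT).
Qed.

(** * Intersection density and point stabilizers *)

Section Density.
Variables (V : finType) (H : {group {perm V}}).

Lemma intersecting_stabilizer v : intersecting 'C_H[v | 'P].
Proof.
apply/forall_inP => f /setIP[_ /astab1P fv].
apply/forall_inP => g /setIP[_ /astab1P gv].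
by apply/existsP; exists v; move: fv gv; rewrite /= !apermE => -> ->.
Qed.

(** The stabilizer of [v] is itself intersecting and, by the orbit-stabilizer theorem, has order
    [#|H| / #|V|]. *)
Lemma intersection_density1 v : [transitive H, on [set: V] | 'P] ->
    (forall S : {set {perm V}}, S \subset H -> intersecting S ->
       #|S| <= #|'C_H[v | 'P]|) ->
  intersection_density H = 1%R.
Proof.
move=> trH maxS; rewrite /intersection_density.
have -> : \max_(S : {set {perm V}} | (S \subset H) && intersecting S) #|S|
    = #|'C_H[v | 'P]|.
  apply/eqP; rewrite eqn_leq; apply/andP; split.
    by apply/bigmax_leqP => S /andP[]; apply: maxS.
  by apply: leq_bigmax_cond; rewrite subsetIl intersecting_stabilizer.
have cardH : #|H| = (#|V| * #|'C_H[v | 'P]|)%N.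
  by rewrite -(card_orbit_stab 'P H v) (atransP trH) ?inE // cardsT.
have nzV : (#|V|%:R != 0 :> rat)%R.
  by rewrite Num.Theory.pnatr_eq0 -lt0n; apply/card_gt0P; exists v.
have nzC : (#|'C_H[v | 'P]|%:R != 0 :> rat)%R.
  by rewrite Num.Theory.pnatr_eq0 -lt0n cardG_gt0.
by rewrite cardH natrM mulrAC mulfV // mul1r mulfV.
Qed.
End Density.

(** * Vertex stabilizers in cubic arc-regular and 2-arc-regular graphs *)

Section CubicGraph.
Variables (V : finType) (adj : rel V).
Hypotheses (graph : simple_graph adj) (cubic3 : cubic adj).
Implicit Types (v x y : V) (s : {perm V}) (G H : {group {perm V}}).

Lemma arc1 x y : adj x y -> [tuple x; y] \in arcs adj 1.
Proof.
move=> xy; rewrite inE /= inE xy !andbT.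
by apply: contraTneq xy => ->; rewrite graph.2.
Qed.

Lemma arc2 x v y : adj v x -> adj v y -> x != y ->
  [tuple x; v; y] \in arcs adj 2.
Proof.
move=> vx vy ne_xy; rewrite inE /= !inE vy [adj x v]graph.1 vx.
rewrite !andbT negb_or ne_xy andbT; apply/andP.
by split; [apply: contraTneq vx => -> | apply: contraTneq vy => ->];
  rewrite graph.2.
Qed.

Lemma arc_regular_eq1 k H (t : k.+1.-tuple V) s :
    arc_regular adj k H -> t \in arcs adj k -> s \in H ->
  {in t, forall x, s x = x} -> s = 1.
Proof.
case=> _ regH /regH stab1 Hs fix_t; apply/set1gP; rewrite -stab1 inE Hs.
by apply/astab1P/val_inj; rewrite /= map_id_in.
Qed.

Lemma AutG_nbr s v : s \in AutG adj -> s v = v ->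
  {homo s : x / x \in [set y | adj v y]}.
Proof.
rewrite inE => /forallP/(_ v)/forallP s_adj sv x; rewrite !inE -{2}sv.
by rewrite (eqP (s_adj x)).
Qed.

(** If [s] fixes a neighbour of [v], it fixes an arc and is trivial. Otherwise it rotates the three
    neighbours, and its cube fixes an arc. *)
Lemma stabilizer_cube G s v : G \subset AutG adj -> arc_regular adj 1 G ->
  s \in G -> s v = v -> s ^+ 3 = 1.
Proof.
move=> sGA regG Gs sv; have /AutG_nbr/(_ sv) sN := subsetP sGA s Gs.
have fix1 x g : adj v x -> g \in G -> g v = v -> g x = x -> g = 1.
  move=> vx Gg gv gx; apply: (arc_regular_eq1 regG (arc1 vx) Gg) => z.
  by rewrite !inE => /orP[]/eqP->.
have [[x] | fix3] := perm_card3 (cubic3 v) sN.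
  by rewrite inE => vx sx; rewrite (fix1 x s) ?expg1n.
have /card_gt0P[x Nx]: 0 < #|[set y | adj v y]| by rewrite cubic3.
apply: (fix1 x); rewrite ?groupX ?(fix3 x) //; first by rewrite inE in Nx.
by rewrite !expgS expg0 mulg1 !permM !sv.
Qed.

(** If [s] fixes a neighbour of [v], then [s ^+ 2] lies in [G] and fixes an arc. Otherwise [s ^+ 3]
    fixes a 2-arc centred at [v], so [s] has cube 1 and equals [(s ^+ 2) ^+ 2], which puts it in
    [G]. *)
Lemma stabilizer_square G s v : G \subset AutG adj -> arc_regular adj 1 G ->
    arc_regular adj 2 (AutG adj) ->
  s \in AutG adj -> s ^+ 2 \in G -> s \notin G -> s v = v -> s ^+ 2 = 1.
Proof.
move=> sGA regG regA As Gs2 nGs sv; have sN := AutG_nbr As sv.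
have [[x] | fix3] := perm_card3 (cubic3 v) sN.
  rewrite inE => vx sx; apply: (arc_regular_eq1 regG (arc1 vx) Gs2) => z.
  by rewrite expgS expg1 permM !inE => /orP[]/eqP->; rewrite ?sv ?sx.
have [x [y [Nx Ny ne_xy]]] : exists x y, [/\ adj v x, adj v y & x != y].
  have /card_gt1P[x [y [+ + ne_xy]]]: 1 < #|[set y | adj v y]|.
    by rewrite cubic3.
  by rewrite !inE; exists x, y.
have s3 : s ^+ 3 = 1.
  apply: (@arc_regular_eq1 _ (AutG_group adj) _ _ regA (arc2 Nx Ny ne_xy)).
    exact: groupX.
  move=> z; rewrite !inE => /or3P[]/eqP->; rewrite ?(fix3 x) ?(fix3 y) ?inE //.
  by rewrite !expgS expg0 mulg1 !permM !sv.
case/negP: nGs; have -> : s = (s ^+ 2) ^+ 2.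
  by rewrite -expgM expgS s3 mulg1.
exact: groupX.
Qed.

Lemma arc_transitive1 G v : arc_transitive adj 1 G ->
  [transitive G, on [set: V] | 'P].
Proof.
move=> trG; have nbr x : exists y, adj x y.
  have /card_gt0P[y] : 0 < #|[set y | adj x y]| by rewrite cubic3.
  by rewrite inE; exists y.
apply/imsetP; exists v; rewrite ?inE //; apply/eqP; rewrite eq_sym.
rewrite -subTset; apply/subsetP => x _.
have [[v' vv'] [x' xx']] := (nbr v, nbr x).
have [s Gs /(congr1 val)[-> _]] := atransP2 trG (arc1 vv') (arc1 xx').
exact: mem_orbit.
Qed.

(** The stabilizer is transitive on the 2-arcs with middle vertex [v], which correspond to the six
    ordered pairs of distinct neighbours. *)
Lemma card_stabilizer_ge6 v : arc_regular adj 2 (AutG adj) ->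
  6 <= #|'C_(AutG adj)[v | 'P]|.
Proof.
move=> [trA _]; pose N := [set y | adj v y].
have /card_gt1P[a [b [+ + ne_ab]]]: 1 < #|N| by rewrite cubic3.
rewrite !inE => va vb.
pose pr (s : {perm V}) := (s a, s b).
pose P := setX N N :\: [set (x, x) | x in N].
have cardP : #|P| = 6.
  rewrite cardsD cardsX cubic3 (setIidPr _); last first.
    by apply/subsetP => _ /imsetP[x Nx ->]; rewrite inE Nx.
  by rewrite card_imset ?cubic3 // => x y [].
rewrite -cardP; apply: leq_trans (leq_imset_card pr _); apply: subset_leq_card.
apply/subsetP=> [[x y]]; rewrite !inE /= => /andP[ne_xy /andP[vx vy]].
have {}ne_xy : x != y.
  by apply: contraNneq ne_xy => <-; apply/imsetP; exists x; rewrite ?inE.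
have [s As /(congr1 val)[-> vE ->]] :=
  atransP2 trA (arc2 va vb ne_ab) (arc2 vx vy ne_xy).
by apply: (imset_f pr); rewrite inE As; apply/astab1P.
Qed.
End CubicGraph.

(** * Intersecting families as configurations of matrices *)

Section IntersectingBound.

Variables (F : finFieldType) (V : finType) (adj : rel V).
Variable phi : {morphism PGL 2 F >-> {perm V}}.
Hypothesis (nz6 : (6%:R != 0 :> F)%R).
Hypotheses (graph : simple_graph adj) (cubic3 : cubic adj).
Hypotheses (phi_inj : 'injm phi) (phi_im : phi @* PGL 2 F = AutG adj).
Hypotheses (regA : arc_regular adj 2 (AutG adj)).
Hypotheses (regG : arc_regular adj 1 (phi @* PSL 2 F)).

Local Notation G := (phi @* PSL 2 F)%G.
Local Notation psi := (invm phi_inj).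

Let PSL_sub : PSL 2 F \subset PGL 2 F.
Proof. by apply: quotientS; apply/subsetP=> x _; rewrite inE. Qed.

Let sub_GA : G \subset AutG adj.
Proof. by rewrite -phi_im morphimS. Qed.

Let mem_psi s : s \in AutG adj -> psi s \in PGL 2 F.
Proof. by rewrite -phi_im => /morphimP[a a_in _ ->]; rewrite /= invmE. Qed.

Let psi_PSL s : s \in AutG adj -> (psi s \in PSL 2 F) = (s \in G).
Proof.
rewrite -phi_im => /morphimP[a a_in _ ->]; rewrite /= invmE //.
apply/idP/idP => [| /morphimP[b b_in PSLb /(injmP phi_inj)->] //].
exact: mem_morphim.
Qed.

Let index2 s t : s \in AutG adj -> t \in AutG adj -> s \notin G -> t \notin G ->
  s * t \in G.
Proof.
move=> As At; rewrite -!psi_PSL ?groupM // => s_ns t_ns.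
rewrite morphM ?phi_im //.
by apply: PSL_mul_nonmembers; rewrite ?mem_psi.
Qed.

Let X (f : {perm V}) : 'M[F]_2 := GLval (repr (psi f)).

Lemma intersecting_polar (S : {set {perm V}}) f g :
    S \subset AutG adj -> intersecting S -> f \in S -> g \in S -> f != g ->
  if f * g^-1 \in G then (polar (X f) (X g) ^+ 2 = \det (X f) * \det (X g))%R
  else polar (X f) (X g) = 0%R.
Proof.
move=> /subsetP sSA intS Sf Sg ne_fg.
have [Af Ag] := (sSA f Sf, sSA g Sg).
have Ah : f * g^-1 \in AutG adj by rewrite groupM ?groupV.
have /existsP[v /eqP fv_gv] := forall_inP (forall_inP intS f Sf) g Sg.
have hv : (f * g^-1) v = v by rewrite permM fv_gv permK.
have memA s : s \in AutG adj -> s \in phi @* PGL 2 F by rewrite phi_im.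
have psi_ne : psi f != psi g.
  by apply: contraNneq ne_fg => /(injmP (injm_invm phi_inj))->; rewrite ?memA.
have psi_h n : (f * g^-1) ^+ n = 1 -> (psi f * (psi g)^-1) ^+ n = 1.
  have <- : psi (f * g^-1) = psi f * (psi g)^-1.
    by rewrite morphM ?morphV ?groupV ?memA.
  by rewrite -(morphX (invm_morphism phi_inj)) ?memA // => ->; apply: morph1.
case: ifPn => [Gh | nGh].
  apply: polar_order3 psi_ne (psi_h 3 _).
  exact: (stabilizer_cube graph cubic3 sub_GA regG Gh hv).
apply: polar_order2 psi_ne (psi_h 2 _).
apply: (stabilizer_square graph cubic3 sub_GA regG regA Ah _ nGh hv).
by rewrite expgS expg1 index2.
Qed.

Lemma intersecting_le6 (S : {set {perm V}}) :
  S \subset AutG adj -> intersecting S -> #|S| <= 6.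
Proof.
move=> sSA intS; have [-> | [f0 Sf0]] := set_0Vmem S; first by rewrite cards0.
(* [S0] is the right coset of [G] through [f0]; as [G] has index at most 2, the rest of [S] also
   lies in a single coset. *)
pose q f := f * f0^-1; pose S0 := [set f | q f \in G].
have Aq f : f \in S -> q f \in AutG adj.
  by move=> Sf; rewrite groupM ?groupV ?(subsetP sSA).
have qE f g : f * g^-1 = q f * (q g)^-1.
  by rewrite invMg invgK mulgA mulgKV.
have S_uniq (P : {set {perm V}}) : pairwise (fun f g => f != g) (enum P).
  by rewrite -uniq_pairwise enum_uniq.
rewrite -(cardsID S0 S) !cardE -!(size_map X).
apply: size_equiangular => //.
- apply/allP => x; rewrite mem_cat => /orP[]/mapP[f _ ->] /=;
    exact: (GL_det (repr (psi f))).
- rewrite pairwise_map.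
  apply: (sub_in_pairwise (P := mem (S :&: S0))) (S_uniq _).
    move=> f g /setIP[Sf]; rewrite inE => qf.
    case/setIP=> Sg; rewrite inE => qg ne_fg.
    have := intersecting_polar sSA intS Sf Sg ne_fg.
    by rewrite qE groupM ?groupV // => /eqP.
  by apply/allP => f; rewrite mem_enum.
- rewrite pairwise_map.
  apply: (sub_in_pairwise (P := mem (S :\: S0))) (S_uniq _).
    move=> f g /setDP[Sf]; rewrite inE => qf.
    case/setDP=> Sg; rewrite inE => qg ne_fg.
    have := intersecting_polar sSA intS Sf Sg ne_fg.
    by rewrite qE index2 ?groupV ?Aq // => /eqP.
  by apply/allP => f; rewrite mem_enum.
apply/allrelP => _ _ /mapP[f + ->] /mapP[g + ->].
rewrite !mem_enum => /setIP[Sf]; rewrite inE => qf.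
case/setDP=> Sg; rewrite inE => qg.
have ne_fg : f != g by apply: contraNneq qg => <-.
have := intersecting_polar sSA intS Sf Sg ne_fg.
by rewrite qE groupMl // groupV (negPf qg) => /eqP.
Qed.

End IntersectingBound.

Theorem theorem7p1
  (p k : nat) (hp : prime p) (hodd : odd p) (hk : (0 < k)%N)
  (F : finFieldType) (hF : #|F| = (p ^ k)%N)
  (V : finType) (adj : rel V)
  (hX : simple_graph adj) (hcubic : cubic adj)
  (harc : arc_transitive adj 1 (AutG adj))
  (htype : type_1_21 adj)
  (phi : {morphism PGL 2 F >-> {perm V}})
  (hfull : isom (PGL 2 F) (AutG adj) phi)
  (hreg : arc_regular adj 1 (phi @* PSL 2 F))
  (hmod : p = 0 %[mod 5] \/ p = 1 %[mod 5] \/ p = 4 %[mod 5]) :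
  intersection_density (AutG adj) = 1%R.
Proof.
have [regA _ _] := htype; have [phi_inj phi_im] := isomP hfull.
(* The characteristic is neither 2, by oddness, nor 3, by the residue condition modulo 5. *)
have nz6 : (6%:R != 0 :> F)%R.
  rewrite -(dvdn_pcharf (card_finPcharP hF hp)).
  apply/negP => p6; have {}p6 : p \in divisors 6 by rewrite -dvdn_divisors.
  by move: p6 hodd hmod hp; rewrite !inE => /or4P[]/eqP-> // _ [|[|]].
(* Transitivity on arcs includes the existence of an arc, whose first vertex serves as [v]. *)
have [v _] : exists v : V, true.
  by case/imsetP: harc => t _ _; exists (thead t).
apply: (@intersection_density1 _ (AutG_group adj) v).
  exact: (arc_transitive1 (G := AutG_group adj) hX hcubic v harc).
move=> S sSA intS; apply: leq_trans (card_stabilizer_ge6 hX hcubic v regA).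
exact: (intersecting_le6 nz6 hX hcubic phi_inj phi_im regA hreg sSA intS).
Qed.
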